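(* Let $X$ be a topological space. The following conditions are equivalent: (a) $X$ is extremally disconnected; (b) $A^{-} \cap B^{-} = (A \cap B)^{-}$ for all open subsets $A$ and $B$ of $X$; (c) $A^{-} \cap B^{-} = \emptyset$ for all open subsets $A$ and $B$ of $X$ with $A \cap B = \emptyset$; (d) $K^{-o-} \cap A^{-} = \emptyset$ for all subsets $K$ of $X$ and all open subsets $A$ of $X$ with $K \cap A = \emptyset$; (e) $K^{-o} \cap A^{-} = (K \cap A)^{-o}$ for all subsets $K$ of $X$ and all open subsets $A$ of $X$; (f) $A^{-o} \cup B^{-o} = (A \cup B)^{-o}$ for all open subsets $A$ and $B$ of $X$; (g) $G^{o} \cup H^{o} = (G \cup H)^{o}$ for all closed subsets $G$ and $H$ of $X$.
   Context: A topological space $X$ is extremally disconnected if the closure of every open subset of $X$ is open in $X$ (no separation axiom is assumed). For a subset $A \subseteq X$, $A^{o}$ denotes the interior of $A$ and $A^{-}$ the closure of $A$ in $X$. Superscripts are applied from left to right: $A^{-o} = (A^{-})^{o}$ is the interior of the closure of $A$, and $A^{-o-} = ((A^{-})^{o})^{-}$ is the closure of the interior of the closure of $A$. *)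

(* Defs.v *)
From mathcomp Require Import all_boot.
From mathcomp Require Import all_classical topology.

Set Implicit Arguments.
Unset Strict Implicit.
Unset Printing Implicit Defensive.

Local Open Scope classical_set_scope.

(* No separation axiom is assumed, and X may be empty. *)
Definition extremally_disconnected (X : topologicalType) : Prop :=
  forall U : set X, open U -> open (closure U).

(* Main.v *)
(* The main tool is that an open set U satisfies U `&` closure A `<=`
   closure (U `&` A).  With A := ~` closure U, condition (d) says that closure U
   misses the closure of its own complement, i.e. is open; taking K := setT in
   (e) gives closure A = interior (closure A).  For (f) -> (g), a point of
   W := interior (G `|` H) lies in closure (W `\` H), with W `\` H an open
   subset of G, or in W `\` closure (W `\` H), an open subset of H, so that W is
   inside the closure of the union of the interiors.  For (g) -> (a), apply (g)
   to closure U and ~` U, which cover X. *)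
Require Import Defs.
From mathcomp Require Import all_boot.
From mathcomp Require Import all_classical topology.

Set Implicit Arguments.
Unset Strict Implicit.
Unset Printing Implicit Defensive.

Local Open Scope classical_set_scope.

Lemma open_setI_closure (X : topologicalType) (U A : set X) :
  open U -> U `&` closure A `<=` closure (U `&` A).
Proof.
move=> oU x [Ux clAx] V Vx.
have [y [Ay [Vy Uy]]] := clAx _ (filterI Vx (open_nbhs_nbhs (conj oU Ux))).
by exists y.
Qed.

Lemma closure_sub_closure (X : topologicalType) (A B : set X) :
  A `<=` closure B -> closure A `<=` closure B.
Proof.
move=> /closureS; rewrite -(closure_id (closure B)).1 //.
exact: closed_closure.
Qed.

Lemma regular_disjoint_extremally_disconnected (X : topologicalType) :
  (forall K A : set X, open A -> K `&` A = set0 ->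
    closure (interior (closure K)) `&` closure A = set0) ->
  extremally_disconnected X.
Proof.
move=> disj U oU.
have Uo : U `<=` interior (closure U).
  by rewrite -open_subsetE //; exact: subset_closure.
have oC : open (~` closure U) by rewrite openC; exact: closed_closure.
have UC0 : U `&` ~` closure U = set0.
  by apply/disjoints_subset; rewrite setCK; exact: subset_closure.
have := disj _ _ oC UC0; rewrite closure_setC => /disjoints_subset.
rewrite setCK => clU; rewrite openE => x clUx.
by apply: clU; exact: closureS Uo _ clUx.
Qed.

Theorem theorem3 (X : topologicalType) :
  [<-> extremally_disconnected X;
       forall A B : set X, open A -> open B ->
         closure A `&` closure B = closure (A `&` B);
       forall A B : set X, open A -> open B -> A `&` B = set0 ->
         closure A `&` closure B = set0;
       forall K A : set X, open A -> K `&` A = set0 ->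
         closure (interior (closure K)) `&` closure A = set0;
       forall K A : set X, open A ->
         interior (closure K) `&` closure A = interior (closure (K `&` A));
       forall A B : set X, open A -> open B ->
         interior (closure A) `|` interior (closure B) =
         interior (closure (A `|` B));
       forall G H : set X, closed G -> closed H ->
         interior G `|` interior H = interior (G `|` H)].
Proof.
tfae.
- move=> ED A B oA oB; apply/seteqP; split; last exact: closureI.
  (* The tool is used twice: first with the open set [closure A], then with [B]. *)
  apply: subset_trans (open_setI_closure (ED _ oA)) _.
  apply: closure_sub_closure; rewrite setIC [A `&` B]setIC.
  exact: open_setI_closure.
- by move=> clI A B oA oB AB0; rewrite clI // AB0 closure0.
(* (c) applies to [interior (closure K)] and [A]: a common point would lie in the closure of the
   empty set [K]&[A]. *)
- move=> disj K A oA KA0; apply: disj => //; first exact: open_interior.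
  apply/seteqP; split=> // x [/interior_subset clKx Ax].
  by rewrite -(closure0 X) -KA0 setIC; apply: open_setI_closure.
(* Recovering (a) first makes [closure A] open, hence the left side too, so it need only lie in
   [closure (K]&[A)]. *)
- move=> disj K A oA; have ED := regular_disjoint_extremally_disconnected disj.
  apply/seteqP; split; last first.
    move=> x KAx; split.
      by apply: interiorS KAx; apply: closureS; exact: subIsetl.
    by apply: closureS (interior_subset KAx); exact: subIsetr.
  rewrite -open_subsetE; last exact: openI (open_interior _) (ED _ oA).
  apply: subset_trans (open_setI_closure (open_interior _)) _.
  apply: closure_sub_closure => x [/interior_subset clKx Ax].
  by rewrite setIC; apply: open_setI_closure.
- move=> intI.
  have ED : extremally_disconnected X.
    move=> U oU; have := intI setT U oU.
    rewrite setTI -(closure_id setT).1; last exact: closedT.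
    rewrite (interior_id _).1 ?setTI; last exact: openT.
    by move=> ->; exact: open_interior.
  (* All the closures are open, so the interiors drop out. *)
  move=> A B oA oB; rewrite closureU !(interior_id _).1 //.
  + exact: openU (ED _ oA) (ED _ oB).
  + exact: ED.
  + exact: ED.
- move=> intU G H cG cH; apply/seteqP; split; first exact: interiorU.
  have GH : interior (G `|` H) `<=` closure (interior G `|` interior H).
    set W := interior (G `|` H); have oW : open W := open_interior _.
    have WH : W `\` H `<=` interior G.
      rewrite -open_subsetE; last by apply: openI => //; rewrite openC.
      by move=> x [/interior_subset[]].
    rewrite closureU => x Wx.
    have [clx|nclx] := pselect (closure (W `\` H) x).
      by left; exact: closureS WH _ clx.
    right; apply: subset_closure.
    have : W `\` closure (W `\` H) `<=` interior H; last exact.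
    rewrite -open_subsetE.
      move=> y [Wy ncly]; apply: contrapT => nHy.
      by apply: ncly; exact: subset_closure.
    by apply: openI => //; rewrite openC; exact: closed_closure.
  (* The left side is open, so it lies in the interior of that closure. By (f) this interior splits
     over [interior G] and [interior H], whose closures stay in the closed sets [G] and [H]. *)
  move: GH; rewrite open_subsetE; last exact: open_interior.
  rewrite -intU; [|exact: open_interior..] => /subset_trans; apply.
  apply: setUSS; apply: interiorS.
  + by rewrite [X in _ `<=` X](closure_id G).1 //; exact: closureS (@interior_subset _ _).
  + by rewrite [X in _ `<=` X](closure_id H).1 //; exact: closureS (@interior_subset _ _).
- move=> intU U oU.
  have clUU : closure U `|` ~` U = setT.
    by apply/seteqP; split=> // x _; have [/subset_closure|] := pselect (U x);
       [left|right].
  have := intU (closure U) (~` U) (@closed_closure _ U).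
  rewrite clUU closedC interiorC (interior_id setT).1; last exact: openT.
  move=> /(_ oU) clU; rewrite openE => x clUx.
  by have : [set: X] x by []; rewrite -clU => -[|/(_ clUx)].
Qed.
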